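(* Let $A\in\mathbb{R}^{M\times N}$ with $M<N$ have nonzero columns and let $d\in\mathbb{R}^M$. Given $\omega\subseteq\{1,\dots,N\}$, let $\hat u$ solve the problem $(\mathcal P_\omega)$: minimize $\|Au-d\|_2^2$ over $u\in\mathbb{R}^N$ subject to $u[i]=0$ for all $i\in\{1,\dots,N\}\setminus\omega$. Then for any $\beta>0$, the objective $F_d(u)=\|Au-d\|_2^2+\beta\|u\|_0$ reaches a (local) minimum at $\hat u$, and $\sigma(\hat u)\subseteq\omega$.
   Context: For $u\in\mathbb{R}^N$, $\sigma(u)=\{i\in\{1,\dots,N\}: u[i]\ne0\}$ is the support and $\|u\|_0=\#\sigma(u)$ its cardinality. $F_d$ reaches a (local) minimum at $\hat u$ if there is an open neighborhood $O$ of $\hat u$ with $F_d(\hat u)=\min_{u\in O}F_d(u)$. *)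

(* Defs.v *)
From mathcomp Require Import all_boot all_order all_algebra.
From mathcomp Require Import all_classical all_reals all_analysis.

Set Implicit Arguments.
Unset Strict Implicit.
Unset Printing Implicit Defensive.

Import Order.TTheory GRing.Theory Num.Theory.
Import numFieldNormedType.Exports.

Local Open Scope classical_set_scope.
Local Open Scope ring_scope.

(* The Euclidean norm; the norm `|v| of the library on matrices is the sup
   norm. *)
Definition norm2 (R : realType) (n : nat) (v : 'cV[R]_n) : R :=
  Num.sqrt (\sum_(i < n) v i 0 ^+ 2).

Definition supp (R : realType) (n : nat) (u : 'cV[R]_n) : {set 'I_n} :=
  [set i | u i 0 != 0]%SET.

Definition norm0 (R : realType) (n : nat) (u : 'cV[R]_n) : nat := #|supp u|.

Definition Fd (R : realType) (M N : nat) (A : 'M[R]_(M, N)) (d : 'cV[R]_M)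
    (beta : R) (u : 'cV[R]_N) : R :=
  norm2 (A *m u - d) ^+ 2 + beta * (norm0 u)%:R.

Definition reaches_local_min (R : realType) (T : topologicalType) (F : T -> R)
    (x : T) : Prop :=
  exists O : set T, [/\ open O, O x & forall y, O y -> F x <= F y].

Definition feasible (R : realType) (N : nat) (omega : {set 'I_N})
    (u : 'cV[R]_N) : Prop :=
  forall i, i \notin omega -> u i 0 = 0.

Definition solves_P (R : realType) (M N : nat) (A : 'M[R]_(M, N))
    (d : 'cV[R]_M) (omega : {set 'I_N}) (u : 'cV[R]_N) : Prop :=
  feasible omega u /\
  forall v : 'cV[R]_N, feasible omega v ->
    norm2 (A *m u - d) ^+ 2 <= norm2 (A *m v - d) ^+ 2.

(* Main.v *)
(* Near the minimizer no coordinate of its support vanishes, so nearby points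
   have at least as large a support. A nearby point supported in omega cannot
   improve the quadratic term; any other one has a strictly larger support,
   which costs at least beta, whereas by continuity the quadratic term
   decreases by less than beta. *)
Require Import Defs.
From mathcomp Require Import all_boot all_order all_algebra.
From mathcomp Require Import all_classical all_reals all_analysis.
From mathcomp Require Import lra.

Set Implicit Arguments.
Unset Strict Implicit.
Unset Printing Implicit Defensive.

Import Order.TTheory GRing.Theory Num.Theory.
Import numFieldNormedType.Exports.

Local Open Scope ring_scope.

Lemma sqr_norm2 (R : realType) (n : nat) (v : 'cV[R]_n) :
  norm2 v ^+ 2 = \sum_(i < n) v i 0 ^+ 2.
Proof. by rewrite sqr_sqrtr// sumr_ge0// => i _; exact: sqr_ge0. Qed.

(** Squaring removes the root and leaves a finite sum of squares of affine functions of the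
    coordinates. *)
Lemma residual_continuous (R : realType) (M N : nat) (A : 'M[R]_(M, N))
    (d : 'cV[R]_M) :
  continuous (fun u : 'cV[R]_N => norm2 (A *m u - d) ^+ 2).
Proof.
under eq_fun do rewrite sqr_norm2.
apply: continuous_big; first exact: add_continuous.
move=> i _; under eq_fun do rewrite !mxE expr2.
have cA : continuous (fun u : 'cV[R]_N => \sum_j A i j * u j 0 - d i 0).
  move=> u; apply: continuousB; last exact: cst_continuous.
  apply: continuous_big u; first exact: add_continuous.
  move=> j _ v; apply: continuousM; first exact: cst_continuous.
  exact: coord_continuous.
move=> u; exact: (continuousM (cA u) (cA u)).
Qed.

(** Each nonzero coordinate stays nonzero nearby by continuity; there are finitely many indices, so
    one neighborhood serves them all. *)
Lemma supp_subset_near (R : realType) (N : nat) (u : 'cV[R]_N) :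
  (\forall v \near u, supp u \subset supp v)%classic.
Proof.
pose P i (v : 'cV[R]_N) : Prop := u i 0 != 0 -> v i 0 != 0.
suff: (\forall v \near u, forall i, P i v)%classic.
  apply: filterS => v uv; apply/fintype.subsetP => i.
  by rewrite !inE; exact: uv.
apply: (@filter_forall _ _ P (nbhs u)) => i.
have [ui0|ui0] := eqVneq (u i 0) 0.
  by apply: nearW => v; rewrite /P ui0 eqxx.
have := cvgr_neq0 _ (@coord_continuous _ _ _ i 0 u) ui0.
by move/(_ (nbhs_filter u)); apply: filterS => v vi0 _.
Qed.

Lemma feasible_supp (R : realType) (N : nat) (omega : {set 'I_N})
    (u : 'cV[R]_N) : feasible omega u <-> supp u \subset omega.
Proof.
split=> [u0|/fintype.subsetP uo i].
  apply/fintype.subsetP => i; rewrite inE.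
  by apply: contraNT => /u0 ->.
by apply: contraNeq => ui0; apply: uo; rewrite inE.
Qed.

Theorem proposition2p3 (R : realType) (M N : nat) (A : 'M[R]_(M, N))
    (d : 'cV[R]_M) (ltMN : (M < N)%N) (colA : forall j : 'I_N, col j A != 0)
    (omega : {set 'I_N}) (uhat : 'cV[R]_N) (uhatP : solves_P A d omega uhat) :
  forall beta : R, 0 < beta ->
    reaches_local_min (Fd A d beta) uhat /\ supp uhat \subset omega.
Proof.
move=> beta beta0; have [/feasible_supp suo umin] := uhatP.
split=> //.
suff Fmin : (\forall v \near uhat, Fd A d beta uhat <= Fd A d beta v)%classic.
  (* Taking the interior turns the neighborhood into an open set that still contains [uhat]. *)
  exists (interior [set v | Fd A d beta uhat <= Fd A d beta v])%classic.
  split=> //; first exact: open_interior.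
  exact: interior_subset.
(* Since [beta] is positive, this bound is strict, so by continuity it persists for the residual at
   nearby points. *)
have ltG : norm2 (A *m uhat - d) ^+ 2 - beta < norm2 (A *m uhat - d) ^+ 2.
  by rewrite ltrBlDr ltrDl.
near=> v.
have suv : supp uhat \subset supp v by near: v; exact: supp_subset_near.
have ltGv : norm2 (A *m uhat - d) ^+ 2 - beta < norm2 (A *m v - d) ^+ 2.
  near: v.
  have := cvgr_gt _ (@residual_continuous R M N A d uhat) _ ltG.
  by move/(_ (nbhs_filter uhat)).
have [svo|nsvo] := boolP (supp v \subset omega).
  apply: lerD; first exact/umin/feasible_supp.
  by rewrite ler_pM2l// ler_nat subset_leq_card.
(* The inclusion is proper: equal supports would put [supp v] inside [omega]. *)
have : (norm0 uhat < norm0 v)%N.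
  apply: proper_card; rewrite properE suv.
  by apply: contra nsvo => svu; exact: (fintype.subset_trans svu suo).
(* Over the naturals, [<] means that the successor is at most the right side; scaled by [beta], the
   penalty grows by at least [beta], which outweighs the loss allowed by [ltGv]. *)
rewrite -(ler_nat R) -(ler_pM2l beta0) mulrSr mulrDr mulr1 /Fd.
by lra.
Unshelve. all: by end_near. Qed.
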